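(* Let $A$ be a finite alphabet, $u$ a word over $A$, $k\ge 0$ an integer, and $a_1,\ldots,a_k\in A$. Then $$\binom{u}{a_1\cdots a_k}_q=\sum_{\substack{u_0,u_1,\ldots,u_k\in A^*\\ u=u_0a_1u_1\cdots u_{k-1}a_k u_k}} q^{\sum_{i=1}^k i|u_i|},$$ where the sum ranges over all tuples $(u_0,\ldots,u_k)$ of words with $u=u_0a_1u_1\cdots u_{k-1}a_ku_k$.
   Context: $A^*$ is the free monoid of finite words over $A$ (with concatenation and empty word $\varepsilon$), and $|w|$ is the length of a word $w$. The $q$-binomial coefficient $\binom{u}{v}_q\in\mathbb{N}[q]$ of two words $u,v\in A^*$ is defined recursively by $\binom{u}{\varepsilon}_q=1$, $\binom{\varepsilon}{v}_q=0$ if $v\neq\varepsilon$, and, for all $u,v\in A^*$ and letters $a,b\in A$, $\binom{ua}{vb}_q=q^{|vb|}\binom{u}{vb}_q+\delta_{a,b}\binom{u}{v}_q$, where $\delta_{a,b}$ is the Kronecker delta. *)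

(* Defs.v *)
From HB Require Import structures.
From mathcomp Require Import all_boot all_order all_algebra.
From mathcomp Require Import boolp classical_sets functions cardinality fsbigop.

Set Implicit Arguments.
Unset Strict Implicit.
Unset Printing Implicit Defensive.

Import Order.TTheory GRing.Theory.

Local Open Scope classical_set_scope.
Local Open Scope ring_scope.

(* Words over A are sequences over A, and q is the variable 'X of {poly nat}. *)

(* The defining recursion consumes words from their last letter, so it is
   written on mirrored words; [qbin0r], [qbin0l] and [qbin_rcons] below are the
   recursion on the words themselves. *)
Fixpoint qbin_rev (A : eqType) (ru rv : seq A) : {poly nat} :=
  match rv, ru with
  | [::], _ => 1
  | _ :: _, [::] => 0
  | b :: rv', a :: ru' =>
      'X^(size rv) * qbin_rev ru' rv + (a == b)%:R * qbin_rev ru' rv'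
  end.

Definition qbin (A : eqType) (u v : seq A) : {poly nat} :=
  qbin_rev (rev u) (rev v).

Lemma qbin0r (A : eqType) (u : seq A) : qbin u [::] = 1.
Proof. by rewrite /qbin; case: (rev u). Qed.

Lemma qbin0l (A : eqType) (v : seq A) : v <> [::] -> qbin [::] v = 0.
Proof. by case/lastP: v => // v b _; rewrite /qbin rev_rcons. Qed.

Lemma qbin_rcons (A : eqType) (u v : seq A) (a b : A) :
  qbin (rcons u a) (rcons v b) =
    'X^(size (rcons v b)) * qbin u (rcons v b) + (a == b)%:R * qbin u v.
Proof. by rewrite /qbin !rev_rcons /= size_rev size_rcons. Qed.

(* u_0 a_1 u_1 ... a_k u_k; a_(i+1) is [tnth a i], u_(i+1) is
   [tnth us (lift ord0 i)], for i : 'I_k. *)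
Definition interleave (A : Type) (k : nat) (a : k.-tuple A)
    (us : k.+1.-tuple (seq A)) : seq A :=
  tnth us ord0 ++ \big[cat/[::]]_(i < k) (tnth a i :: tnth us (lift ord0 i)).

Definition factorizations (A : Type) (k : nat) (u : seq A) (a : k.-tuple A) :
    set (k.+1.-tuple (seq A)) :=
  [set us | u = interleave a us].

Lemma size_tnth_interleave (A : Type) (k : nat) (a : k.-tuple A)
    (us : k.+1.-tuple (seq A)) (i : 'I_k.+1) :
  (size (tnth us i) <= size (interleave a us))%N.
Proof.
rewrite size_cat (big_morph size (@size_cat A) (erefl : size [::] = 0%N)).
case: (unliftP ord0 i) => [j ->|->]; last exact: leq_addr.
by rewrite (bigD1 j) //= addnCA; apply: leq_trans (leqnSn _) (leq_addr _ _).
Qed.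

(* A sum over an infinite support would be 0 by convention: *)
Lemma finite_factorizations (A : finType) (k : nat) (u : seq A)
    (a : k.-tuple A) : finite_set (factorizations u a).
Proof.
pose T := {n : 'I_(size u).+1 & n.-tuple A}.
pose f (t : k.+1.-tuple T) : k.+1.-tuple (seq A) :=
  [tuple of map (fun x => tval (tagged x)) t].
apply: (@sub_finite_set _ _ (f @` [set: k.+1.-tuple T])); last first.
  exact/finite_image/finite_finset.
move=> us /= uE.
have ltu i : (size (tnth us i) < (size u).+1)%N.
  by rewrite ltnS uE size_tnth_interleave.
pose t := [tuple Tagged (fun n : 'I_(size u).+1 => n.-tuple A)
  (in_tuple (tnth us i) : (Ordinal (ltu i)).-tuple A) | i < k.+1].
exists t => //.
by apply: eq_from_tnth => i; rewrite tnth_map tnth_mktuple.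
Qed.

(* Main.v *)
Require Import Defs.
From mathcomp Require Import all_boot all_order all_algebra.
From mathcomp Require Import boolp classical_sets functions cardinality fsbigop.

(** Induct on u, removing its last letter x. In a factorization of u x along
    a_1 ... a_k b, either the last factor is nonempty, and then it ends with x
    and deleting this x lowers the exponent of q by k + 1; or the last factor
    is empty, and then b = x and dropping it leaves a factorization of u along
    a_1 ... a_k with the same exponent. These are the two terms of the
    recursion for the q-binomial coefficient. *)

Set Implicit Arguments.
Unset Strict Implicit.
Unset Printing Implicit Defensive.

Local Open Scope ring_scope.

Lemma tnth_rcons_widen (T : Type) (n : nat) (t : n.-tuple T) (x : T)
    (i : 'I_n) : tnth (rcons_tuple t x) (widen_ord (leqnSn n) i) = tnth t i.
Proof.
by rewrite (tnth_nth x) [RHS](tnth_nth x) /= nth_rcons size_tuple ltn_ord.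
Qed.

Lemma tnth_rcons_max (T : Type) (n : nat) (t : n.-tuple T) (x : T) :
  tnth (rcons_tuple t x) ord_max = x.
Proof. by rewrite (tnth_nth x) /= nth_rcons size_tuple ltnn eqxx. Qed.

(** Serves as case analysis from the right, the end at which the recursion for [qbin] consumes
    words. *)
Lemma tuple_rconsP (T : Type) (n : nat) (t : n.+1.-tuple T) :
  exists s x, t = rcons_tuple (s : n.-tuple T) x.
Proof.
have szb : size (belast (thead t) (behead t)) == n.
  by rewrite size_belast size_behead size_tuple.
exists (Tuple szb), (last (thead t) (behead t)); apply: val_inj => /=.
by rewrite -lastI {1}(tuple_eta t).
Qed.

Lemma rcons_tuple_inj (T : Type) (n : nat) (s t : n.-tuple T) (x y : T) :
  rcons_tuple s x = rcons_tuple t y -> s = t /\ x = y.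
Proof. by case/(congr1 val)/rcons_inj => /val_inj. Qed.

Lemma ord0_widen (k : nat) : ord0 = widen_ord (leqnSn k.+1) ord0.
Proof. exact: val_inj. Qed.

(** Factors are indexed through [lift ord0], and the old entries of an [rcons_tuple] through
    [widen_ord]; the two shifts commute because both sides have the same value. *)
Lemma lift0_widen (k : nat) (i : 'I_k) :
  lift ord0 (widen_ord (leqnSn k) i) = widen_ord (leqnSn k.+1) (lift ord0 i).
Proof. exact: val_inj. Qed.

Lemma lift0_max (k : nat) : lift ord0 (ord_max : 'I_k.+1) = ord_max.
Proof. exact: val_inj. Qed.

(** The exponent of q. Index i stands for the factor u_(i+1), whence the coefficient [i.+1]; u_0
    does not contribute. *)
Definition weight (A : Type) (k : nat) (us : k.+1.-tuple (seq A)) : nat :=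
  \sum_(i < k) i.+1 * size (tnth us (lift ord0 i)).

Lemma interleave_rcons (A : Type) (k : nat) (a : k.-tuple A) (b : A)
    (us : k.+1.-tuple (seq A)) (w : seq A) :
  interleave (rcons_tuple a b) (rcons_tuple us w) = interleave a us ++ b :: w.
Proof.
rewrite /interleave {1}ord0_widen tnth_rcons_widen big_ord_recr /=.
rewrite tnth_rcons_max lift0_max tnth_rcons_max catA.
congr ((_ ++ _) ++ _); apply: eq_bigr => i _.
by rewrite tnth_rcons_widen lift0_widen tnth_rcons_widen.
Qed.

Lemma weight_rcons (A : Type) (k : nat) (us : k.+1.-tuple (seq A))
    (w : seq A) :
  weight (rcons_tuple us w) = (weight us + k.+1 * size w)%N.
Proof.
rewrite /weight big_ord_recr /= lift0_max tnth_rcons_max; congr addn.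
by apply: eq_bigr => i _; rewrite lift0_widen tnth_rcons_widen.
Qed.

Definition append_last (A : Type) (k : nat) (x : A)
    (us : k.+1.-tuple (seq A)) : k.+1.-tuple (seq A) :=
  [tuple if i == ord_max then rcons (tnth us i) x else tnth us i | i < k.+1].

Lemma append_last_rcons (A : Type) (k : nat) (x : A) (us : k.-tuple (seq A))
    (w : seq A) :
  append_last x (rcons_tuple us w) = rcons_tuple us (rcons w x).
Proof.
apply: eq_from_tnth => i; rewrite tnth_mktuple.
case: eqP => [->|/eqP neq_i]; first by rewrite !tnth_rcons_max.
(* An index other than the last one points into [us], which is left unchanged. *)
have ltik : (i < k)%N by rewrite ltn_neqAle neq_i -ltnS ltn_ord.
have -> : i = widen_ord (leqnSn k) (Ordinal ltik) by exact: val_inj.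
by rewrite !tnth_rcons_widen.
Qed.

Lemma append_last_inj (A : Type) (k : nat) (x : A) :
  injective (@append_last A k x).
Proof.
move=> us vs; have [us' [v ->]] := tuple_rconsP us.
have [vs' [w ->]] := tuple_rconsP vs; rewrite !append_last_rcons.
by move=> eq_t; have [-> /rcons_inj[->]] := rcons_tuple_inj eq_t.
Qed.

(** The last factor has coefficient k + 1, so one more letter there costs k + 1. The length [k.+2]
    keeps the last factor distinct from u_0, which has coefficient 0. *)
Lemma weight_append_last (A : Type) (k : nat) (x : A)
    (us : k.+2.-tuple (seq A)) :
  weight (append_last x us) = (k.+1 + weight us)%N.
Proof.
have [us' [w ->]] := tuple_rconsP us.
by rewrite append_last_rcons !weight_rcons size_rcons mulnS addnCA.
Qed.

Local Open Scope classical_set_scope.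

Lemma factorizations_tuple0 (A : Type) (u : seq A) (a : 0.-tuple A) :
  factorizations u a = [set [tuple u]].
Proof.
apply/seteqP; split=> us; rewrite /factorizations /interleave /= big_ord0 cats0.
  by move=> ->; apply: eq_from_tnth => i; rewrite (ord1 i).
by move=> ->.
Qed.

Lemma factorizations_nil (A : Type) (k : nat) (a : k.+1.-tuple A) :
  factorizations [::] a = set0.
Proof.
apply/seteqP; split=> us //; have [us' [w ->]] := tuple_rconsP us.
have [a' [b ->]] := tuple_rconsP a.
rewrite /factorizations /= interleave_rcons => /(congr1 size).
by rewrite size_cat addnS.
Qed.

(** The first image collects the factorizations with nonempty last factor, the second those with
    empty last factor; the conditional is the Kronecker delta at the level of sets. *)
Lemma factorizations_rcons (A : eqType) (k : nat) (u : seq A) (x b : A)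
    (a : k.-tuple A) :
  factorizations (rcons u x) (rcons_tuple a b) =
    append_last x @` factorizations u (rcons_tuple a b) `|`
    (fun us => rcons_tuple us [::]) @`
      (if x == b then factorizations u a else set0).
Proof.
apply/seteqP; split=> us; last first.
  case=> -[vs]; last first.
    case: eqP => // <- /= -> <-.
    by rewrite /factorizations /= interleave_rcons cats1.
  have [vs' [w ->]] := tuple_rconsP vs; rewrite /factorizations /= => -> <-.
  by rewrite append_last_rcons !interleave_rcons rcons_cat.
have [us' [w ->]] := tuple_rconsP us.
rewrite /factorizations /= interleave_rcons.
(* If w is empty, the last letter x is b itself; otherwise x is the last letter of w. *)
case/lastP: w => [|w y].
  by rewrite cats1 => /rcons_inj[-> ->]; right; exists us'; rewrite ?eqxx.
rewrite -rcons_cons -rcons_cat => /rcons_inj[-> ->]; left.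
exists (rcons_tuple us' w); first by rewrite interleave_rcons.
by rewrite append_last_rcons.
Qed.

Lemma qbin_factorizations (A : finType) (u : seq A) (k : nat)
    (a : k.-tuple A) :
  qbin u a = \sum_(us \in factorizations u a) ('X^(weight us) : {poly nat}).
Proof.
(* The tuple is generalized because the delta term calls the hypothesis on a tuple shorter by one
   letter. *)
elim/last_ind: u k a => [|u x IHu] [|k] a.
- by rewrite tuple0 qbin0r factorizations_tuple0 fsbig_set1 /weight big_ord0.
- rewrite factorizations_nil fsbig_set0 qbin0l //.
  by move/(congr1 size); rewrite size_tuple.
- by rewrite tuple0 qbin0r factorizations_tuple0 fsbig_set1 /weight big_ord0.
have [a' [b ->]] := tuple_rconsP a; rewrite factorizations_rcons fsbigU /=.
- rewrite qbin_rcons size_rcons size_tuple; congr (_ + _).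
    rewrite fsbig_image; last first.
      by apply: in2W; exact: append_last_inj.
    (* Finiteness of the support turns both sums into ordinary finite ones, over which the power of
       q distributes. *)
    rewrite (IHu _ (rcons_tuple a' b)) !fsbig_finite;
      try exact: finite_factorizations.
    rewrite big_distrr /=; apply: eq_bigr => us _.
    by rewrite weight_append_last GRing.exprD.
  case: eqP => _; last by rewrite GRing.mul0r image_set0 fsbig_set0.
  rewrite GRing.mul1r IHu fsbig_image; last first.
    by move=> us vs _ _ eq_t; have [] := rcons_tuple_inj eq_t.
  by apply: eq_fsbigr => us _; rewrite weight_rcons muln0 addn0.
- exact/finite_image/finite_factorizations.
- apply: finite_image; case: ifP => _ //; exact: finite_factorizations.
(* The two images are disjoint: the last factor ends with x in the first and is empty in the
   second. *)
move=> _ [[vs _ <-] [ws _]].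
have [vs' [w ->]] := tuple_rconsP vs; rewrite append_last_rcons.
move=> eq_t; have [_ /(congr1 size)] := rcons_tuple_inj eq_t.
by rewrite size_rcons.
Qed.

Local Close Scope classical_set_scope.
Unset Implicit Arguments.

Theorem theorem3p1 (A : finType) (u : seq A) (k : nat) (a : k.-tuple A) :
  qbin u a =
  \sum_(us \in factorizations u a)
    ('X^(\sum_(i < k) i.+1 * size (tnth us (lift ord0 i)))%N : {poly nat}).
Proof. exact: qbin_factorizations. Qed.
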